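(* Let $F,G:\mathbf{Vect}\to\mathbf{Vect}$ be polynomial functors over $\mathbb R$, and suppose that $F$ is reduced. Then any set-theoretic transformation $T:F\to G$ is polynomial, i.e. for every finite-dimensional real vector space $V$ the map $T_V:F(V)\to G(V)$ is a polynomial function. If $G$ is polynomial of degree $d$, then $T$ is polynomial of degree $d$ (each $T_V$ is polynomial of degree $d$).
   Context: $\mathbf{Vect}$ is the category of finite-dimensional real vector spaces and linear maps. Convention: ''polynomial of degree $d$'' means of degree at most $d$. A functor $F:\mathbf{Vect}\to\mathbf{Vect}$ is polynomial of degree $d$ if for every $V$ and all $f_1,\dots,f_n\in\mathrm{End}(V)$, the map $(\lambda_1,\dots,\lambda_n)\mapsto F(\lambda_1f_1+\cdots+\lambda_nf_n)$ is a polynomial of degree $d$ in $\lambda_1,\dots,\lambda_n$ with coefficients in $\mathrm{End}(F(V))$; it is polynomial if this holds for some $d$. Writing $F(\lambda\,\mathrm{id}_V)=\sum_{i=0}^d\lambda^i\mathbf e_i(V)$, the $\mathbf e_i(V)\in\mathrm{End}(F(V))$ are orthogonal idempotents, and with $F_i=\mathbf e_iF$ one has $F=\bigoplus_iF_i$; $F$ is reduced if $F_0=0$. A set-theoretic transformation $T:F\to G$ is a natural transformation of the underlying set-valued functors, i.e. maps of sets $T_V:F(V)\to G(V)$, not assumed linear, natural in linear maps. A function $f:V\to W$ between real vector spaces is polynomial (of degree $d$) if for every finite set $v_1,\dots,v_n\in V$ there is a polynomial $g\in W\otimes_{\mathbb R}\mathbb R[t_1,\dots,t_n]$ (of degree $d$)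 with $f(\lambda_1v_1+\cdots+\lambda_nv_n)=g(\lambda_1,\dots,\lambda_n)$ for all $\lambda_i\in\mathbb R$. *)

(* Defs.v *)
From HB Require Import structures.
From mathcomp Require Import all_boot all_order all_algebra reals.

Set Implicit Arguments.
Unset Strict Implicit.
Unset Printing Implicit Defensive.

Import GRing.Theory.
Local Open Scope ring_scope.

(* [vectType R] is the type of finite-dimensional R-vector spaces. *)
Record vfunctor (R : realType) := VFunctor {
  fobj :> vectType R -> vectType R;
  fmap : forall V W : vectType R, 'Hom(V, W) -> 'Hom(fobj V, fobj W);
  fmap_id : forall V : vectType R, fmap (\1%VF : 'End(V)) = \1%VF;
  fmap_comp : forall (U V W : vectType R) (g : 'Hom(V, W)) (f : 'Hom(U, V)),
    fmap (g \o f)%VF = (fmap g \o fmap f)%VF }.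

Arguments fmap {R} v {V W} _.

(* The components are plain functions: no linearity is assumed. *)
Record set_trans (R : realType) (F G : vfunctor R) := SetTrans {
  tcomp :> forall V : vectType R, F V -> G V;
  tcomp_natural : forall (V W : vectType R) (f : 'Hom(V, W)) (x : F V),
    tcomp (fmap F f x) = fmap G f (tcomp x) }.

Arguments tcomp {R F G} s V _.

(* [p] is given by an element of W (x) R[t_1, ..., t_n] of total degree at
   most d, [c m] being its coefficient at t^m.  The exponents of a monomial of
   total degree at most d are at most d, so its multi-index lies in the finite
   type {ffun 'I_n -> 'I_d.+1}. *)
Definition vpoly_deg (R : realType) (W : lmodType R) (n d : nat)
    (p : ('I_n -> R) -> W) : Prop :=
  exists c : {ffun 'I_n -> 'I_d.+1} -> W, forall l : 'I_n -> R,
    p l = \sum_(m : {ffun 'I_n -> 'I_d.+1} | (\sum_(i < n) m i <= d)%N)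
            (\prod_(i < n) l i ^+ m i) *: c m.

Definition polyfun_deg (R : realType) (V W : lmodType R) (d : nat)
    (f : V -> W) : Prop :=
  forall (n : nat) (v : 'I_n -> V),
    vpoly_deg d (fun l : 'I_n -> R => f (\sum_(i < n) l i *: v i)).

(* The degree may depend on the finite family [v]. *)
Definition polyfun (R : realType) (V W : lmodType R) (f : V -> W) : Prop :=
  forall (n : nat) (v : 'I_n -> V),
    exists d : nat,
      vpoly_deg d (fun l : 'I_n -> R => f (\sum_(i < n) l i *: v i)).

Definition polyfunctor_deg (R : realType) (d : nat) (F : vfunctor R) : Prop :=
  forall (V : vectType R) (n : nat) (f : 'I_n -> 'End(V)),
    vpoly_deg d (fun l : 'I_n -> R => fmap F (\sum_(i < n) l i *: f i)).

Definition polyfunctor (R : realType) (F : vfunctor R) : Prop :=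
  exists d : nat, polyfunctor_deg d F.

Definition hcomponents (R : realType) (F : vfunctor R) (V : vectType R)
    (d : nat) (e : 'I_d.+1 -> 'End(F V)) : Prop :=
  forall l : R, fmap F (l *: (\1%VF : 'End(V))) = \sum_(i < d.+1) l ^+ i *: e i.

(* F_0 = 0, where F_0(V) is the image of e_0(V).  For a polynomial functor F
   such families e exist, and e_0 does not depend on the choice of (d, e)
   (evaluate at l = 0). *)
Definition reduced (R : realType) (F : vfunctor R) : Prop :=
  forall V : vectType R, exists (d : nat) (e : 'I_d.+1 -> 'End(F V)),
    hcomponents e /\ limg (e ord0) = 0%VS.

(* Main.v *)
Require Import Defs.
From HB Require Import structures.
From mathcomp Require Import all_boot all_order all_algebra reals.

(** Everything reduces to one fact about the reduced functor F
    (lincomb_linear_parameters): given x_1, ..., x_n in F(V), there are a space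
    W, a vector y in F(W) and linear maps p_0, ..., p_n : W -> V such that
      F(p_0 + l_1 p_1 + ... + l_n p_n) y = l_1 x_1 + ... + l_n x_n
    for all scalars l_a.  Naturality of T then gives
      T_V(l_1 x_1 + ... + l_n x_n) = G(p_0 + l_1 p_1 + ... + l_n p_n) (T_W y),
    and the right-hand side is polynomial in l of degree at most d as soon as
    G is polynomial of degree d.

    To find y, take W = V^(n+1), with injections i_0, ..., i_n and projections
    p_0, ..., p_n, and put
      y = sum_a int_0^1 (d/db at b = 0) F(t i_0 + b i_a) x_a dt.
    Since (p_0 + sum_c l_c p_c) o (t i_0 + b i_a) = (t + l_a b) id_V, applying
    F(p_0 + sum_c l_c p_c) to the a-th summand yields
      int_0^1 (d/db at b = 0) F((t + l_a b) id_V) x_a dt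
        = l_a (F(id_V) - F(0)) x_a = l_a x_a,
    where F(0) = e_0 vanishes because F is reduced.  On polynomials of bounded
    degree the derivative at 0 and the integral over [0, 1] are finite
    combinations of point evaluations; the proof defines y with these
    combinations (deriv_int_weights) in place of d/db and int. *)

Import GRing.Theory Num.Theory.
Local Open Scope ring_scope.

(** The evaluations at 0, 1, ..., d span the linear forms on polynomials of
    degree at most d, because the Vandermonde matrix is invertible; [b i] is
    the prescribed value of the form at the i-th power. *)
Lemma moment_weights (R : numFieldType) (d : nat) (b : 'I_d.+1 -> R) :
  exists u : 'I_d.+1 -> R,
    forall i : 'I_d.+1, \sum_(r < d.+1) u r * (r%:R : R) ^+ i = b i.
Proof.
pose a : 'rV[R]_d.+1 := \row_r r%:R.
have VU : Vandermonde d.+1 a \in unitmx.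
  rewrite unitmxE det_Vandermonde unitfE.
  apply/prodf_neq0 => i _; apply/prodf_neq0 => j ltij.
  by rewrite !mxE subr_eq0 eqr_nat neq_ltn ltij orbT.
exists (fun r => (invmx (Vandermonde d.+1 a) *m \col_i b i) r 0) => i.
have /matrixP/(_ i 0) := mulKVmx VU (\col_i b i).
rewrite [RHS]mxE => <-; rewrite [RHS]mxE; apply: eq_bigr => r _.
by rewrite !mxE mulrC.
Qed.

(** The weights [u] represent the derivative at 0 and [v] the integral over
    [0, 1]: applied to the k-th power of s + l r, the derivative in r gives
    k l s^(k-1), and integrating in s turns this into l for k > 0 (and 0 for
    k = 0). *)
Lemma deriv_int_weights (R : numFieldType) (d : nat) :
  exists u v : 'I_d.+1 -> R, forall (l : R) (k : nat), (k <= d)%N ->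
    \sum_(r < d.+1) \sum_(s < d.+1) u r * v s * (s%:R + l * r%:R) ^+ k
    = l *+ (0 < k)%N.
Proof.
have [u uP] := moment_weights R d (fun i => (i == 1%N :> nat)%:R).
have [v vP] := moment_weights R d (fun i => i.+1%:R^-1).
exists u, v => l k lekd.
transitivity (\sum_(i < k.+1) (l ^+ i *+ 'C(k, i)) *
    ((\sum_(r < d.+1) u r * r%:R ^+ i) *
     (\sum_(s < d.+1) v s * s%:R ^+ (k - i)))).
  under [RHS]eq_bigr do rewrite mulr_suml mulr_sumr.
  rewrite [RHS]exchange_big; apply: eq_bigr => r _ /=.
  under [RHS]eq_bigr do rewrite mulr_sumr mulr_sumr.
  rewrite [RHS]exchange_big; apply: eq_bigr => s _ /=.
  rewrite exprDn mulr_sumr; apply: eq_bigr => i _.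
  rewrite exprMn -mulrnAr -mulrnAl [u r * v s]mulrC mulrACA.
  by rewrite [u r * (_ * _)]mulrCA mulrCA [v s * _ * _]mulrC.
have moments (i : 'I_k.+1) : (\sum_(r < d.+1) u r * r%:R ^+ i) *
    (\sum_(s < d.+1) v s * s%:R ^+ (k - i))
    = (i == 1%N :> nat)%:R / (k - i).+1%:R.
  have ltid : (i < d.+1)%N by rewrite (leq_trans (ltn_ord i)).
  have ltkid : (k - i < d.+1)%N by rewrite ltnS (leq_trans (leq_subr _ _)).
  by rewrite (uP (Ordinal ltid)) (vP (Ordinal ltkid)).
(* Only the term i = 1 survives, with value (l *+ k) / k. *)
under eq_bigr do rewrite moments.
case: k lekd {moments} => [|k] lekd; first by rewrite big_ord1 mul0r mulr0.
rewrite 2!big_ord_recl big1 => [|i _]; last by rewrite mul0r mulr0.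
by rewrite mul0r mulr0 add0r addr0 /= bin1 subSS subn0 mul1r expr1 mulrnAl
  -mulrnAr -[_ *+ k.+1]mulr_natr mulVf ?mulr1 ?pnatr_eq0.
Qed.

Lemma power_biproduct (R : realType) (V : vectType R) (n : nat) :
  exists (W : vectType R) (inj : 'I_n -> 'Hom(V, W)) (pr : 'I_n -> 'Hom(W, V)),
    forall i j, (pr i \o inj j)%VF = if i == j then \1%VF else 0.
Proof.
pose inj0 (j : 'I_n) (x : V) := [ffun i : 'I_n => if i == j then x else 0].
pose pr0 (i : 'I_n) (w : {ffun 'I_n -> V}) := w i.
have inj_lin j : linear (inj0 j).
  move=> a x y; apply/ffunP => i; rewrite !ffunE.
  by case: ifP; rewrite ?scaler0 ?addr0.
have pr_lin i : linear (pr0 i) by move=> a x y; rewrite /pr0 !ffunE.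
pose injL j : {linear V -> {ffun 'I_n -> V}} :=
  HB.pack (inj0 j) (GRing.isLinear.Build _ _ _ _ (inj0 j) (inj_lin j)).
pose prL i : {linear {ffun 'I_n -> V} -> V} :=
  HB.pack (pr0 i) (GRing.isLinear.Build _ _ _ _ (pr0 i) (pr_lin i)).
exists {ffun 'I_n -> V}, (fun j => linfun (injL j)), (fun i => linfun (prL i)).
move=> i j; apply/lfunP => x; rewrite comp_lfunE !lfunE /= /pr0 /inj0 ffunE.
by case: ifP; rewrite ?lfunE.
Qed.

(** Polynomiality of G is a condition on endomorphisms only.  It extends to
    maps W -> V when V is a retract of W, by writing f = r o (s o f) with s o f
    an endomorphism of W. *)
Lemma vpoly_deg_hom (R : realType) (G : vfunctor R) (d : nat)
    (polyG : polyfunctor_deg d G) (V W : vectType R)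
    (r : 'Hom(W, V)) (s : 'Hom(V, W)) (rs : (r \o s)%VF = \1%VF)
    (n : nat) (f : 'I_n -> 'Hom(W, V)) (z : G W) :
  vpoly_deg d (fun l : 'I_n -> R => fmap G (\sum_(i < n) l i *: f i) z).
Proof.
have [c cP] := polyG W n (fun i => s \o f i)%VF.
exists (fun m => fmap G r (c m z)) => l.
have -> : \sum_(i < n) l i *: f i = (r \o \sum_(i < n) l i *: (s \o f i))%VF.
  apply/lfunP => x; rewrite comp_lfunE !sum_lfunE linear_sum /=.
  apply: eq_bigr => i _; rewrite !scale_lfunE linearZ /= -!comp_lfunE.
  by rewrite comp_lfunA rs comp_lfun1l.
rewrite fmap_comp comp_lfunE cP sum_lfunE linear_sum /=.
by apply: eq_bigr => m _; rewrite scale_lfunE linearZ.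
Qed.

(** Setting the variable of index 0 to 1 merges the monomials that agree in the
    other variables, and does not raise the degree. *)
Lemma vpoly_deg_dehomogenize (R : realType) (W : lmodType R) (n d : nat)
    (p : ('I_n.+1 -> R) -> W) :
  vpoly_deg d p ->
  vpoly_deg d (fun l : 'I_n -> R => p (fun j => oapp l 1 (unlift ord0 j))).
Proof.
case=> c cP.
pose res (m : {ffun 'I_n.+1 -> 'I_d.+1}) : {ffun 'I_n -> 'I_d.+1} :=
  [ffun i => m (lift ord0 i)].
(* [res m = q] makes the coefficient of q collect all powers of variable 0. *)
exists (fun q => \sum_(m : {ffun 'I_n.+1 -> 'I_d.+1} |
   (\sum_(i < n.+1) m i <= d)%N && (res m == q)) c m) => l.
rewrite cP (partition_big res (fun q => \sum_(i < n) q i <= d)%N) /=; last first.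
  move=> m; apply: leq_trans; rewrite big_ord_recl.
  by under eq_bigr do rewrite ffunE; rewrite leq_addl.
apply: eq_bigr => q _; rewrite scaler_sumr; apply: eq_bigr => m /andP[_ /eqP <-].
congr (_ *: _); rewrite big_ord_recl unlift_none expr1n mul1r.
by apply: eq_bigr => i _; rewrite liftK ffunE.
Qed.

(** Linear combinations in F(V) are the images of one fixed vector [y] under
    maps that depend affinely on the coefficients; the map [p ord0] carries the
    constant coefficient 1.  The section [s] makes V a retract of W, as
    [vpoly_deg_hom] requires. *)
Lemma lincomb_linear_parameters (R : realType) (F : vfunctor R)
    (redF : reduced F) (V : vectType R) (n : nat) (x : 'I_n -> F V) :
  exists (W : vectType R) (p : 'I_n.+1 -> 'Hom(W, V)) (s : 'Hom(V, W)) (y : F W),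
    (p ord0 \o s)%VF = \1%VF /\
    forall l : 'I_n -> R,
      fmap F (\sum_(j < n.+1) oapp l 1 (unlift ord0 j) *: p j) y
      = \sum_(a < n) l a *: x a.
Proof.
have [W [inj [pr prinj]]] := power_biproduct R V n.+1.
have [d [e [eP e0]]] := redF V.
have [u [v uvP]] := deriv_int_weights R d.
(* The double sum over r and t replaces the integral in t of the derivative
   at b = 0 of F(t i_0 + b i_a) x_a. *)
exists W, pr, (inj ord0), (\sum_(a < n) \sum_(r < d.+1) \sum_(t < d.+1)
  (u r * v t) *: fmap F (t%:R *: inj ord0 + r%:R *: inj (lift ord0 a)) (x a)).
split=> [|l]; first by rewrite prinj eqxx.
have e0x z : e ord0 z = 0.
  by apply/eqP; rewrite -memv0 -e0 memv_img ?memvf.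
have sumex z : \sum_(i < d.+1) e i z = z.
  rewrite -[RHS]id_lfunE -[in RHS](fmap_id F) -(scale1r \1%VF) eP sum_lfunE.
  by apply: eq_bigr => i _; rewrite expr1n scale1r.
set f := \sum_j _.
have finj j : (f \o inj j)%VF = oapp l 1 (unlift ord0 j) *: \1%VF.
  apply/lfunP => z; rewrite comp_lfunE sum_lfunE (bigD1 j) //= big1.
    by rewrite addr0 scale_lfunE -comp_lfunE prinj eqxx -scale_lfunE.
  move=> i /negbTE neij.
  by rewrite scale_lfunE -comp_lfunE prinj neij lfunE scaler0.
rewrite linear_sum; apply: eq_bigr => a _ /=.
(* Decompose F((t + l_a r) id) x_a along the e_i, so that the weights act on
   the scalar powers only. *)
transitivity (\sum_(i < d.+1) (\sum_(r < d.+1) \sum_(t < d.+1)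
    u r * v t * (t%:R + l a * r%:R) ^+ i) *: e i (x a)).
  rewrite linear_sum; under [RHS]eq_bigr do rewrite scaler_suml.
  rewrite [RHS]exchange_big; apply: eq_bigr => r _ /=.
  rewrite linear_sum; under [RHS]eq_bigr do rewrite scaler_suml.
  rewrite [RHS]exchange_big; apply: eq_bigr => t _ /=.
  rewrite linearZ /= -comp_lfunE -fmap_comp.
  have -> : (f \o (t%:R *: inj ord0 + r%:R *: inj (lift ord0 a)))%VF
            = (t%:R + l a * r%:R) *: \1%VF.
    rewrite comp_lfunDr -!comp_lfunZr !finj unlift_none liftK /= scale1r.
    by rewrite scalerDl scalerA [l a * _]mulrC.
  rewrite eP sum_lfunE scaler_sumr; apply: eq_bigr => i _.
  by rewrite scale_lfunE scalerA.
rewrite -[in RHS](sumex (x a)) scaler_sumr; apply: eq_bigr => i _.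
(* Each degree i > 0 contributes l_a e_i(x_a); degree 0 contributes 0, which
   agrees with l_a e_0(x_a) because F is reduced. *)
rewrite (uvP (l a) i); last by rewrite -ltnS.
case: (posnP i) => [i0|_]; last by rewrite mulr1n.
have -> : i = ord0 by apply: val_inj.
by rewrite e0x !scaler0.
Qed.

Theorem theoremA26 (R : realType) (F G : vfunctor R)
    (polyF : polyfunctor F) (polyG : polyfunctor G) (redF : reduced F)
    (T : set_trans F G) :
  (forall V : vectType R, polyfun (tcomp T V)) /\
  (forall d : nat, polyfunctor_deg d G ->
     forall V : vectType R, polyfun_deg d (tcomp T V)).
Proof.
have main d : polyfunctor_deg d G ->
    forall V : vectType R, polyfun_deg d (tcomp T V).
  move=> polyGd V n x.
  have [W [p [s [y [ps yP]]]]] := lincomb_linear_parameters R F redF V n x.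
  have /vpoly_deg_dehomogenize[c cP] :=
    vpoly_deg_hom R G d polyGd V W (p ord0) s ps n.+1 p (tcomp T W y).
  by exists c => l; rewrite -cP -yP tcomp_natural.
split=> // V n x; have [d polyGd] := polyG.
by exists d; apply: main.
Qed.
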